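(* Let $\rho_1,\rho_2$ be density matrices with a priori probabilities $p_1,p_2$ ($p_1+p_2=1$), with supports $\mathcal S_{\rho_1},\mathcal S_{\rho_2}$, on the Hilbert space $\mathcal H=\mathcal S_{\rho_1}+\mathcal S_{\rho_2}$. Suppose the supports have a non-trivial common subspace $\mathcal H_\cap:=\mathcal S_{\rho_1}\cap\mathcal S_{\rho_2}\neq\{0\}$. Let $\mathcal H'$ be the orthogonal complement of $\mathcal H_\cap$ in $\mathcal H$, and let $\Pi_{\mathcal H_\cap}$, $\Pi_{\mathcal H'}$ be the orthogonal projections onto $\mathcal H_\cap$, $\mathcal H'$. Define the reduced problem on $\mathcal H'$ by $$\rho_i'=\frac1{N_i}\Pi_{\mathcal H'}\rho_i\Pi_{\mathcal H'},\qquad p_i'=\frac{N_ip_i}{N},\qquad N_i=\mathrm{Tr}(\rho_i\Pi_{\mathcal H'})\qquad(i=1,2),\qquad N=N_1p_1+N_2p_2 .$$ Then the optimal unambiguous state discrimination measurements are characterised as follows: a triple $\{F_?,F_1,F_2\}$ of operators on $\mathcal H$ is an optimal unambiguous state discrimination measurement for $(\rho_1,\rho_2;p_1,p_2)$ on $\mathcal H$ if and only if $$F_1=F_1',\qquad F_2=F_2',\qquad F_?=F_?'+\Pi_{\mathcal H_\cap},$$ where $\{F_?',F_1',F_2'\}$ is a POVM on $\mathcal H'$ (its elements being extended by $0$ on $\mathcal H_\cap$) that is an optimal unambiguous state discrimination measurement for $(\rho_1',\rho_2';p_1',p_2')$ on $\mathcal H'$. Moreover, the corresponding failure probabilities satisfy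 $$Q[\{F_k\}]=(1-N_1)p_1+(1-N_2)p_2+N\,Q'[\{F_k'\}],$$ where $Q'$ denotes the failure probability for the reduced problem.
   Context: All Hilbert spaces are finite-dimensional and complex. A density matrix is a positive semi-definite Hermitian operator of trace $1$. The support $\mathcal S_P$ of a positive semi-definite Hermitian operator $P$ is the span of its eigenvectors with non-zero eigenvalues. A POVM on a Hilbert space $\mathcal H$ is a family $\{F_k\}$ of positive semi-definite Hermitian operators on $\mathcal H$ with $\sum_kF_k=\mathbb 1_{\mathcal H}$. An unambiguous state discrimination measurement (USDM) on $\mathcal H$ for density matrices $\rho_1,\rho_2$ is a POVM $\{F_?,F_1,F_2\}$ on $\mathcal H$ with $\mathrm{Tr}(\rho_1F_2)=0=\mathrm{Tr}(\rho_2F_1)$. Given a priori probabilities $p_1,p_2$, its failure probability is $Q[\{F_k\}]=p_1\mathrm{Tr}(\rho_1F_?)+p_2\mathrm{Tr}(\rho_2F_?)$. A USDM is optimal if its failure probability is minimal among all USDMs for $\rho_1,\rho_2$ on $\mathcal H$. *)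

(* Defs.v *)
From HB Require Import structures.
From mathcomp Require Import all_boot all_order all_algebra.
From mathcomp Require Export complex.
From mathcomp Require Export reals.

Set Implicit Arguments.
Unset Strict Implicit.
Unset Printing Implicit Defensive.

Import Order.TTheory GRing.Theory Num.Theory.
Local Open Scope ring_scope.

(* The ambient Hilbert space is 'rV[C]_n with the inner product dotmx.  As
   everywhere in mxalgebra, a matrix A acts on row vectors by v |-> v *m A, and
   a subspace is the row space of a matrix. *)

Notation "V ^_|_" := (orthomx Num.conj (mx_of_hermitian (hermitian1mx _)) V) :
  matrix_set_scope.

Section Operators.
Variables (C : numClosedFieldType) (n : nat).
Implicit Types A V P F rho : 'M[C]_n.

Definition psd A : Prop :=
  A \is hermsymmx /\ forall v : 'rV[C]_n, 0 <= dotmx (v *m A) v.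

Definition density rho : Prop := psd rho /\ \tr rho = 1.

(* The list of roots of the characteristic polynomial (with multiplicity). *)
Definition eigenvalues A : seq C :=
  sval (closed_field_poly_normal (char_poly A)).

Definition supp P : 'M[C]_n :=
  (\sum_(a <- eigenvalues P | a != 0) eigenspace P a)%MS.

(* An operator on a subspace V is identified with its extension by 0 on the
   orthogonal complement of V; in particular the identity of V becomes
   proj_ortho V. *)
Definition operator_on V A : Prop :=
  A = proj_ortho V *m A *m proj_ortho V.

Definition povm V (Fs : seq 'M[C]_n) : Prop :=
  (forall F, F \in Fs -> operator_on V F /\ psd F)
  /\ \sum_(F <- Fs) F = proj_ortho V.

(* Fq is the element F_? of the inconclusive outcome. *)
Definition usdm V rho1 rho2 (Fq F1 F2 : 'M[C]_n) : Prop :=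
  [/\ povm V [:: Fq; F1; F2], \tr (rho1 *m F2) = 0 & \tr (rho2 *m F1) = 0].

Definition failure_prob rho1 rho2 (p1 p2 : C) (Fq : 'M[C]_n) : C :=
  p1 * \tr (rho1 *m Fq) + p2 * \tr (rho2 *m Fq).

(* On C the relation x <= y means that y - x is a nonnegative real; the failure
   probabilities compared here are real. *)
Definition optimal_usdm V rho1 rho2 (p1 p2 : C) (Fq F1 F2 : 'M[C]_n) : Prop :=
  usdm V rho1 rho2 Fq F1 F2 /\
  forall Gq G1 G2 : 'M[C]_n, usdm V rho1 rho2 Gq G1 G2 ->
    failure_prob rho1 rho2 p1 p2 Fq <= failure_prob rho1 rho2 p1 p2 Gq.

End Operators.

(* Main.v *)
(* For positive semidefinite A and B, Tr(AB) = 0 forces AB = 0.  Hence the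
   conditions Tr(rho_1 F_2) = 0 = Tr(rho_2 F_1) make F_1 and F_2 vanish on the
   intersection of the supports, and the POVM condition makes F_? the identity
   there.  Subtracting the projection onto the intersection from F_? is
   therefore a bijection between the USDMs of the two problems, under which the
   failure probability changes by an affine map with slope N >= 0.  When N = 0
   the reduced failure probability is identically 0, so that every USDM is
   optimal on both sides. *)

Require Import Defs.
From mathcomp Require Import all_boot all_order all_algebra.
From mathcomp Require Import ring.

Set Implicit Arguments.
Unset Strict Implicit.
Unset Printing Implicit Defensive.

Import Order.TTheory GRing.Theory Num.Theory.
Local Open Scope ring_scope.
Local Open Scope sesquilinear_scope.

Lemma conjtrmx_mul (C : numClosedFieldType) m n p
    (A : 'M[C]_(m, n)) (B : 'M[C]_(n, p)) :
  (A *m B)^t* = B^t* *m A^t*.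
Proof. by rewrite trmx_mul map_mxM. Qed.

(** * Gram factorisation, traces of products and supports of positive semidefinite matrices *)

Section PositiveSemidefinite.
Variables (C : numClosedFieldType) (n : nat).
Implicit Types A B K : 'M[C]_n.

Lemma psd_conjtrmx A : psd A -> A^t* = A.
Proof. by case=> /is_hermitianmxP; rewrite expr0 scale1r. Qed.

Lemma gram_psd K : psd (K^t* *m K).
Proof.
split=> [|v].
  by apply/is_hermitianmxP; rewrite expr0 scale1r conjtrmx_mul trmxCK.
have -> : dotmx (v *m (K^t* *m K)) v = dotmx (v *m K^t*) (v *m K^t*).
  by rewrite !dotmxE conjtrmx_mul trmxCK !mulmxA.
exact: dnorm_ge0.
Qed.

Lemma row_spectralmx_mul A i : A \is normalmx ->
  row i (spectralmx A) *m A = spectral_diag A 0 i *: row i (spectralmx A).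
Proof.
move=> /orthomx_spectralP defA; rewrite {2}defA rowE !mulmxA.
rewrite mulmxK ?spectral_unit //.
by rewrite -rowE row_diag_mx -scalemxAl.
Qed.

(** The spectral theorem gives [A = P^* D P] with [P] unitary and [D] diagonal. The entries of [D]
    are values of the quadratic form at unit eigenvectors, hence nonnegative, and [K = sqrt(D) P]
    works. *)
Lemma psd_gram A : psd A -> exists K, A = K^t* *m K.
Proof.
case=> Ah A_ge0; have /orthomx_spectralP := hermitian_normalmx Ah.
set P := spectralmx A; set d := spectral_diag A => defA.
have uP : P \is unitarymx := spectral_unitarymx A.
have d_ge0 i : 0 <= d 0 i.
  have := A_ge0 (row i P); rewrite dotmxE.
  rewrite row_spectralmx_mul ?hermitian_normalmx // -/P -/d.
  rewrite -scalemxAl mxE -dotmxE.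
  by have /row_unitarymxP -> := uP; rewrite eqxx mulr1.
pose s := diag_mx (map_mx sqrtC d).
exists (s *m P); rewrite {1}defA invmx_unitary// conjtrmx_mul.
rewrite -!mulmxA; congr (_ *m _); rewrite mulmxA; congr (_ *m _).
rewrite tr_diag_mx map_diag_mx mulmx_diag; congr diag_mx.
apply/rowP=> i; rewrite !mxE /=.
have /geC0_conj -> : 0 <= sqrtC (d 0 i) by rewrite sqrtC_ge0.
by rewrite -expr2 sqrtCK.
Qed.

Lemma conjtrmx_mul_psd A K : psd A -> psd (K^t* *m A *m K).
Proof.
case/psd_gram=> L ->.
have -> : K^t* *m (L^t* *m L) *m K = (L *m K)^t* *m (L *m K).
  by rewrite conjtrmx_mul !mulmxA.
exact: gram_psd.
Qed.

Lemma psdD A B : psd A -> psd B -> psd (A + B).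
Proof.
move=> pA pB; split=> [|v].
  apply/is_hermitianmxP; rewrite expr0 scale1r.
  by rewrite linearD /= map_mxD !psd_conjtrmx.
rewrite mulmxDr dotmxE mulmxDl mxE -!dotmxE.
by rewrite addr_ge0 //; [case: pA | case: pB].
Qed.

Lemma mxtrace_gram m (K : 'M[C]_(m, n)) :
  \tr (K *m K^t*) = \sum_i \sum_j `|K i j| ^+ 2.
Proof.
apply: eq_bigr => i _; rewrite mxE; apply: eq_bigr => j _.
by rewrite !mxE normCK.
Qed.

Lemma mxtrace_gram_ge0 m (K : 'M[C]_(m, n)) : 0 <= \tr (K *m K^t*).
Proof.
by rewrite mxtrace_gram; do 2!apply: sumr_ge0 => ? _; rewrite exprn_ge0.
Qed.

Lemma mxtrace_gram_eq0 m (K : 'M[C]_(m, n)) : \tr (K *m K^t*) = 0 -> K = 0.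
Proof.
rewrite mxtrace_gram => /eqP; rewrite psumr_eq0 => [/allP K0|i _]; last first.
  by apply: sumr_ge0 => j _; rewrite exprn_ge0.
apply/matrixP=> i j; rewrite mxE; have := K0 i (mem_index_enum _).
rewrite psumr_eq0 => [/allP/(_ j (mem_index_enum _))|k _]; last first.
  by rewrite exprn_ge0.
by rewrite sqrf_eq0 normr_eq0 => /eqP.
Qed.

(* With A = K^* K and B = L^* L, the trace of AB is the squared
   Hilbert-Schmidt norm of L K^*. *)
Lemma mxtrace_mul_psd_ge0 A B : psd A -> psd B -> 0 <= \tr (A *m B).
Proof.
case/psd_gram=> K -> /psd_gram[L ->].
rewrite mulmxA mxtrace_mulC !mulmxA -mulmxA.
rewrite -[K in _ *m (K *m _)]trmxCK -conjtrmx_mul.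
exact: mxtrace_gram_ge0.
Qed.

(** A zero Hilbert-Schmidt norm gives [L K^* = 0]; its adjoint [K L^* = 0] is the inner factor of
    [K^* K L^* L]. *)
Lemma mxtrace_mul_psd_eq0 A B :
  psd A -> psd B -> \tr (A *m B) = 0 -> A *m B = 0.
Proof.
case/psd_gram=> K -> /psd_gram[L ->].
rewrite mulmxA mxtrace_mulC !mulmxA -mulmxA.
rewrite -[K in _ *m (K *m _)]trmxCK -conjtrmx_mul => /mxtrace_gram_eq0 LK0.
have KL0 : K *m L^t* = 0.
  by rewrite -[K]trmxCK -conjtrmx_mul LK0 trmx0 map_mx0.
by rewrite -[_ *m K *m _]mulmxA KL0 mulmx0 mul0mx.
Qed.

(** An eigenvector [v] for [a != 0] equals [a^-1 (v A)], so it lies in the row space. With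
    [sub_supp], the support of a Hermitian matrix is its row space. *)
Lemma supp_sub A : (supp A <= A)%MS.
Proof.
rewrite /supp; elim/big_rec: _ => [|a B a0 sB]; first exact: sub0mx.
rewrite addsmx_sub sB andbT; apply/rV_subP => v /eigenspaceP vA.
by rewrite -[v](scalerK a0) -vA scalemx_sub ?submxMl.
Qed.

Lemma mem_eigenvalues A a : (a \in eigenvalues A) = eigenvalue A a.
Proof.
rewrite /eigenvalues; case: closed_field_poly_normal => s /= chA.
rewrite eigenvalue_root_char chA (monicP (char_poly_monic A)) scale1r.
by rewrite root_prod_XsubC.
Qed.

(** In a unitary eigenbasis the row space is spanned by the eigenvectors scaled by their
    eigenvalues; those with eigenvalue zero contribute nothing. *)
Lemma sub_supp A : A \is hermsymmx -> (A <= supp A)%MS.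
Proof.
move=> Ah; have /orthomx_spectralP := hermitian_normalmx Ah.
set P := spectralmx A; set d := spectral_diag A => defA.
have uP : P \in unitmx := spectral_unit A.
rewrite {1}defA -mulmxA; apply: submx_trans (submxMl _ _) _.
apply/row_subP => i; rewrite row_mul row_diag_mx -scalemxAl -rowE.
have [->|di0] := eqVneq (d 0 i) 0; first by rewrite scale0r sub0mx.
apply: scalemx_sub.
have eP : (row i P <= eigenspace A (d 0 i))%MS.
  exact/eigenspaceP/row_spectralmx_mul/hermitian_normalmx.
have evd : d 0 i \in eigenvalues A.
  rewrite mem_eigenvalues; apply/eigenvalueP; exists (row i P).
    exact/eigenspaceP.
  have /row_unitarymxP/(_ i i) := spectral_unitarymx A; rewrite -/P eqxx.
  apply: contra_eq_neq => ->.
  by rewrite dotmxE mul0mx mxE eq_sym oner_neq0.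
apply: submx_trans eP _; rewrite /supp.
by rewrite (big_rem _ evd) /= di0 addsmxSl.
Qed.

End PositiveSemidefinite.

(** * Orthogonal projections onto nested subspaces *)

Section OrthogonalProjection.
Variables (C : numClosedFieldType) (n : nat).
Implicit Types U V W A : 'M[C]_n.

(** [1 - P] maps into the orthogonal complement of [P], so [(1 - P) P^* = 0]. Thus [P^* = P P^*],
    which is self-adjoint. *)
Lemma proj_ortho_conjtrmx U : (proj_ortho U)^t* = proj_ortho U.
Proof.
set P := proj_ortho U.
have /orthomx1P : ((1%:M - P)%R <= P^_|_)%MS.
  rewrite (eqmx_ortho _ (proj_orthoE U)).
  by have := proj_ortho_compl_sub U 1%:M; rewrite mul1mx.
rewrite mulmxBl mul1mx => /subr0_eq; move: P => P PP.
by rewrite -[RHS]trmxCK PP conjtrmx_mul trmxCK.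
Qed.

Lemma proj_ortho_psd U : psd (proj_ortho U).
Proof.
rewrite -(proj_ortho_proj U) -{1}proj_ortho_conjtrmx; exact: gram_psd.
Qed.

(** For self-adjoint [A], [A P = A] yields [P A = A] by taking adjoints, so a one-sided row space
    condition suffices. *)
Lemma operator_onP U A :
  A^t* = A -> operator_on U A <-> (A <= U)%MS.
Proof.
move=> Ah; rewrite /operator_on; split=> [->|AU].
  exact: proj_ortho_sub.
have AP := proj_ortho_id AU.
have := congr1 (fun X : 'M_n => X^t*) AP.
by rewrite /= (conjtrmx_mul A) proj_ortho_conjtrmx Ah -mulmxA AP.
Qed.

Lemma mul_proj_ortho_sub U V : (V <= U)%MS ->
  proj_ortho U *m proj_ortho V = proj_ortho V.
Proof.
move=> VU; have VP: proj_ortho V *m proj_ortho U = proj_ortho V.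
  by rewrite proj_ortho_id // proj_orthoE.
have := congr1 (fun X : 'M_n => X^t*) VP.
by rewrite /= (conjtrmx_mul (proj_ortho V)) !proj_ortho_conjtrmx.
Qed.

Lemma proj_ortho_split U V : (V <= U)%MS ->
  proj_ortho U = proj_ortho (U :&: V^_|_)%MS + proj_ortho V.
Proof.
move=> VU; set W := (U :&: V^_|_)%MS.
have WU : (W <= U)%MS := capmxSl _ _.
have VW : (V <= W^_|_)%MS by rewrite orthomx_sym capmxSr.
have DW : ((proj_ortho U - proj_ortho V)%R <= W)%MS.
  rewrite sub_capmx -{2}(mul_proj_ortho_sub VU) proj_ortho_compl_sub andbT.
  by rewrite addmx_sub ?eqmx_opp ?proj_orthoE.
(* The difference of the projections onto [U] and [V] is unchanged by projecting onto [W]. Its first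
   term then becomes the projection onto [W] since [W <= U], its second 0 since [V] is orthogonal to
   [W]. *)
apply/eqP; rewrite -subr_eq -(proj_ortho_id DW) mulmxBl mul_proj_ortho_sub //.
by rewrite [X in _ - X]proj_ortho_0 ?subr0 // proj_orthoE.
Qed.

End OrthogonalProjection.

(** * Traces and positivity under compressions [P A P] *)

Section Compression.
Variables (C : numClosedFieldType) (n : nat).
Implicit Types A F P Q rho : 'M[C]_n.

(* If \tr (rho *m P) = 0, both sides vanish. *)
Lemma mxtrace_compression rho P F : psd rho -> psd P -> F = P *m F *m P ->
  \tr (rho *m P) * \tr ((\tr (rho *m P))^-1 *: (P *m rho *m P) *m F)
  = \tr (rho *m F).
Proof.
move=> rho_psd P_psd FE.
have trE : \tr (P *m rho *m P *m F) = \tr (rho *m F).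
  by rewrite {2}FE -!mulmxA mxtrace_mulC !mulmxA.
rewrite -scalemxAl linearZ /= trE.
have [N0|N0] := eqVneq (\tr (rho *m P)) 0; last by rewrite mulVKf.
rewrite N0 mul0r FE !mulmxA (mxtrace_mul_psd_eq0 rho_psd P_psd) //.
by rewrite !mul0mx mxtrace0.
Qed.

Lemma mxtrace_compression_eq0 rho P F :
  psd rho -> psd P -> F = P *m F *m P ->
  \tr ((\tr (rho *m P))^-1 *: (P *m rho *m P) *m F) = 0
  <-> \tr (rho *m F) = 0.
Proof.
move=> rho_psd P_psd FE; rewrite -(mxtrace_compression rho_psd P_psd FE).
split=> [->|]; first by rewrite mulr0.
(* At zero mass the default inverse 0 makes the normalised compression the zero matrix. *)
have [-> _|N0] := eqVneq (\tr (rho *m P)) 0.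
  by rewrite invr0 scale0r mul0mx mxtrace0.
by move/eqP; rewrite mulf_eq0 (negPf N0) => /eqP.
Qed.

(** As [P Q = 0], the difference is the compression [P A P]. This keeps [Fq] positive when [Pcap] is
    subtracted. *)
Lemma psd_sub_compression A P Q : P^t* = P -> P *m Q = 0 ->
  A - Q = P *m (A - Q) *m P -> psd A -> psd (A - Q).
Proof.
move=> Ph PQ0 ->; rewrite mulmxBr PQ0 subr0 -{1}Ph.
exact: conjtrmx_mul_psd.
Qed.

End Compression.

(** * Correspondence between measurements on [H] and on [H'] *)

Section Reduction.
Variables (C : numClosedFieldType) (n : nat).
Variables (rho1 rho2 : 'M[C]_n) (p1 p2 : C).
Hypotheses (rho1_density : density rho1) (rho2_density : density rho2).
Hypotheses (p1_ge0 : 0 <= p1) (p2_ge0 : 0 <= p2).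

Let H := (supp rho1 + supp rho2)%MS.
Let Hcap := (supp rho1 :&: supp rho2)%MS.
Let H' := (H :&: Hcap^_|_)%MS.
Let Pcap := proj_ortho Hcap.
Let P' := proj_ortho H'.
Let N1 := \tr (rho1 *m P').
Let N2 := \tr (rho2 *m P').
Let N := N1 * p1 + N2 * p2.
Let rho1' := N1^-1 *: (P' *m rho1 *m P').
Let rho2' := N2^-1 *: (P' *m rho2 *m P').
Let p1' := N1 * p1 / N.
Let p2' := N2 * p2 / N.

Lemma common_sub_sum : (Hcap <= H)%MS.
Proof. exact: submx_trans (capmxSl _ _) (addsmxSl _ _). Qed.

Lemma proj_H : proj_ortho H = P' + Pcap.
Proof. exact: proj_ortho_split common_sub_sum. Qed.

Lemma proj_reduced_ge0 rho : psd rho -> 0 <= \tr (rho *m P').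
Proof. by move=> r; exact: mxtrace_mul_psd_ge0 r (proj_ortho_psd _). Qed.

Lemma reduced_mass_ge0 : 0 <= N.
Proof.
by rewrite addr_ge0 // mulr_ge0 // proj_reduced_ge0 //;
  [case: rho1_density | case: rho2_density].
Qed.

(** The unit trace of [rho] splits between [H'] and [Hcap]. The share of [Hcap] produces the
    constant term of the failure probability. *)
Lemma mxtrace_mul_Pcap rho : density rho -> (rho <= H)%MS ->
  \tr (rho *m Pcap) = 1 - \tr (rho *m P').
Proof.
case=> _ <- /proj_ortho_id; rewrite proj_H mulmxDr => rhoE.
by rewrite -{2}rhoE linearD /= addrAC subrr add0r.
Qed.

Lemma mxtrace_reduced rho F : psd rho -> operator_on H' F ->
  \tr (rho *m P') * \tr ((\tr (rho *m P'))^-1 *: (P' *m rho *m P') *m F)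
  = \tr (rho *m F).
Proof.
by move=> rho_psd; apply: mxtrace_compression => //; exact: proj_ortho_psd.
Qed.

Lemma mxtrace_reduced_eq0 rho F : psd rho -> operator_on H' F ->
  \tr ((\tr (rho *m P'))^-1 *: (P' *m rho *m P') *m F) = 0
  <-> \tr (rho *m F) = 0.
Proof.
by move=> rho_psd; apply: mxtrace_compression_eq0 => //; exact: proj_ortho_psd.
Qed.

(* The vanishing trace gives rho F = 0, so F annihilates Hcap. *)
Lemma operator_on_reduced F rho : psd F -> psd rho -> operator_on H F ->
  (Hcap <= supp rho)%MS -> \tr (rho *m F) = 0 -> operator_on H' F.
Proof.
move=> F_psd rho_psd FH sH tr0; have Fh := psd_conjtrmx F_psd.
apply/operator_onP => //; rewrite sub_capmx ((operator_onP _ Fh).1 FH) /=.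
rewrite orthomx_sym; apply/orthomx1P; rewrite Fh.
have /submxP[D ->] : (Hcap <= rho)%MS := submx_trans sH (supp_sub _).
by rewrite -mulmxA (mxtrace_mul_psd_eq0 rho_psd F_psd) ?mulmx0.
Qed.

Lemma usdm_reduced Fq F1 F2 :
  usdm H rho1 rho2 Fq F1 F2 <->
  usdm H' rho1' rho2' (Fq - Pcap) F1 F2.
Proof.
have [r1 _] := rho1_density; have [r2 _] := rho2_density.
have sumE : Fq + F1 + F2 = proj_ortho H <-> Fq - Pcap + F1 + F2 = P'.
  rewrite proj_H -!(addrAC _ F1) -!(addrAC _ F2); split=> [->|<-].
    by rewrite addrK.
  by rewrite subrK.
have sum3 (X Y Z : 'M[C]_n) : \sum_(F <- [:: X; Y; Z]) F = X + Y + Z.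
  by rewrite !big_cons big_nil addr0 addrA.
split=> [[[ops]]|[[ops]]]; rewrite sum3 => sumF tr1 tr2.
- have [FqH Fqp] := ops Fq (mem_head _ _).
  have [F1H F1p] : operator_on H F1 /\ psd F1.
    by apply: ops; rewrite !inE eqxx !orbT.
  have [F2H F2p] : operator_on H F2 /\ psd F2.
    by apply: ops; rewrite !inE eqxx !orbT.
  (* [F1] annihilates [rho2] and [F2] annihilates [rho1]; each support contains [Hcap]. *)
  have F1H' : operator_on H' F1.
    exact: operator_on_reduced F1p r2 F1H (capmxSr _ _) tr2.
  have F2H' : operator_on H' F2.
    exact: operator_on_reduced F2p r1 F2H (capmxSl _ _) tr1.
  have FqH' : operator_on H' (Fq - Pcap).
    apply/operator_onP.
      by rewrite linearB /= map_mxB (psd_conjtrmx Fqp) proj_ortho_conjtrmx.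
    (* Normalisation on [H] leaves [P' - F1 - F2], whose terms all have row space in [H']. *)
    have -> : Fq - Pcap = P' - F1 - F2.
      by rewrite -(sumE.1 sumF) [_ + F1 + F2]addrAC addrK addrK.
    rewrite !addmx_sub ?eqmx_opp ?proj_orthoE //.
      by apply/operator_onP => //; exact: psd_conjtrmx.
    by apply/operator_onP => //; exact: psd_conjtrmx.
  split; [split|exact/mxtrace_reduced_eq0|exact/mxtrace_reduced_eq0].
    move=> F; rewrite !inE => /or3P[] /eqP-> //; split=> //.
    apply: psd_sub_compression FqH' Fqp; first exact: proj_ortho_conjtrmx.
    by rewrite proj_ortho_0 // proj_orthoE capmxSr.
  by rewrite sum3; exact/sumE.
- have [FqH Fqp] := ops _ (mem_head _ _).
  have [F1H F1p] : operator_on H' F1 /\ psd F1.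
    by apply: ops; rewrite !inE eqxx !orbT.
  have [F2H F2p] : operator_on H' F2 /\ psd F2.
    by apply: ops; rewrite !inE eqxx !orbT.
  have lift F : psd F -> operator_on H' F -> operator_on H F.
    move=> /psd_conjtrmx Fh /(operator_onP _ Fh) FH'; apply/operator_onP => //.
    exact: submx_trans FH' (capmxSl _ _).
  have Fq_psd : psd Fq.
    by rewrite -[Fq](subrK Pcap); apply: psdD => //; exact: proj_ortho_psd.
  split; [split|exact/mxtrace_reduced_eq0|exact/mxtrace_reduced_eq0].
    move=> F; rewrite !inE => /or3P[] /eqP->; split=> //; try exact: lift.
    apply/operator_onP; first exact: psd_conjtrmx.
    rewrite -[Fq](subrK Pcap) addmx_sub ?proj_orthoE ?common_sub_sum //.
    apply/operator_onP; first exact: psd_conjtrmx.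
    exact: lift.
  by rewrite sum3; exact/sumE.
Qed.

Lemma failure_prob_reduced Fq : operator_on H' Fq ->
  failure_prob rho1 rho2 p1 p2 (Fq + Pcap)
  = (1 - N1) * p1 + (1 - N2) * p2
    + N * failure_prob rho1' rho2' p1' p2' Fq.
Proof.
move=> FqH; have [r1 _] := rho1_density; have [r2 _] := rho2_density.
have s1 : (rho1 <= H)%MS.
  by apply: submx_trans (addsmxSl _ _); apply: sub_supp; case: r1.
have s2 : (rho2 <= H)%MS.
  by apply: submx_trans (addsmxSr _ _); apply: sub_supp; case: r2.
have NQ : N * failure_prob rho1' rho2' p1' p2' Fq
          = p1 * \tr (rho1 *m Fq) + p2 * \tr (rho2 *m Fq).
  rewrite -(mxtrace_reduced r1 FqH) -(mxtrace_reduced r2 FqH).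
  rewrite -/N1 -/N2 -/rho1' -/rho2' /failure_prob /p1' /p2'.
  (* If [N != 0], then [N p_i' = N_i p_i] closes the goal. If [N = 0], both nonnegative summands
     [N_i p_i] vanish, and so do both sides. *)
  have [N0|N0] := eqVneq N 0; last by field.
  have N1p : 0 <= N1 * p1 by rewrite mulr_ge0 // proj_reduced_ge0.
  have N2p : 0 <= N2 * p2 by rewrite mulr_ge0 // proj_reduced_ge0.
  have := N0; move/eqP; rewrite paddr_eq0 // => /andP[/eqP N10 /eqP N20].
  by rewrite N0 !mulrA [p1 * _]mulrC [p2 * _]mulrC N10 N20 !mul0r addr0.
rewrite NQ /failure_prob !mulmxDr !linearD /=.
rewrite !(mxtrace_mul_Pcap rho1_density) // !(mxtrace_mul_Pcap rho2_density) //.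
rewrite -/N1 -/N2; ring.
Qed.

Lemma optimal_usdm_reduced Fq F1 F2 :
  optimal_usdm H rho1 rho2 p1 p2 Fq F1 F2 <->
  optimal_usdm H' rho1' rho2' p1' p2' (Fq - Pcap) F1 F2.
Proof.
have failE Gq G1 G2 : usdm H' rho1' rho2' (Gq - Pcap) G1 G2 ->
    failure_prob rho1 rho2 p1 p2 Gq = (1 - N1) * p1 + (1 - N2) * p2
      + N * failure_prob rho1' rho2' p1' p2' (Gq - Pcap).
  case=> [[ops _] _ _]; have [GqH _] := ops _ (mem_head _ _).
  by rewrite -(failure_prob_reduced GqH) subrK.
split=> [[uF optF]|[uF optF]].
  have uF' := (usdm_reduced _ _ _).1 uF; split=> // Gq G1 G2 uG'.
  (* A reduced competitor [Gq] is compared through its lift [Gq + Pcap] to [H]. *)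
  have uG : usdm H' rho1' rho2' (Gq + Pcap - Pcap) G1 G2 by rewrite addrK.
  have := optF _ _ _ ((usdm_reduced _ _ _).2 uG).
  rewrite (failE _ _ _ uF') (failE _ _ _ uG) addrK lerD2l.
  (* For [N > 0] the factor [N] cancels. For [N = 0] the default inverse makes [p1'] and [p2'] zero,
     so both sides of the inequality are 0. *)
  have := reduced_mass_ge0; rewrite le_eqVlt => /orP[/eqP N0 _|N_gt0].
    by rewrite /failure_prob /p1' /p2' -N0 invr0 !mulr0 !mul0r.
  by rewrite ler_pM2l.
split=> [|Gq G1 G2 uG]; first exact/usdm_reduced.
have uG' := (usdm_reduced _ _ _).1 uG.
rewrite (failE _ _ _ uF) (failE _ _ _ uG') lerD2l.
by apply: ler_wpM2l; [exact: reduced_mass_ge0|exact: optF uG'].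
Qed.

End Reduction.

(* If N1, N2 or N vanishes, the quotients below are 0 by the convention
   x / 0 = 0; the theorem is stated for these cases as well. *)
Theorem theorem1 (R : realType) (n : nat) (rho1 rho2 : 'M[R[i]]_n)
    (p1 p2 : R[i])
    (rho1_density : density rho1) (rho2_density : density rho2)
    (p1_ge0 : 0 <= p1) (p2_ge0 : 0 <= p2) (p_sum : p1 + p2 = 1) :
  let S1 := supp rho1 in
  let S2 := supp rho2 in
  let H := (S1 + S2)%MS in
  let Hcap := (S1 :&: S2)%MS in
  let H' := (H :&: Hcap^_|_)%MS in
  let Pcap := proj_ortho Hcap in
  let P' := proj_ortho H' in
  let N1 := \tr (rho1 *m P') in
  let N2 := \tr (rho2 *m P') in
  let N := N1 * p1 + N2 * p2 in
  let rho1' := N1^-1 *: (P' *m rho1 *m P') in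
  let rho2' := N2^-1 *: (P' *m rho2 *m P') in
  let p1' := N1 * p1 / N in
  let p2' := N2 * p2 / N in
  Hcap != 0 ->
  (forall Fq F1 F2 : 'M[R[i]]_n,
     optimal_usdm H rho1 rho2 p1 p2 Fq F1 F2 <->
     exists Fq' F1' F2' : 'M[R[i]]_n,
       [/\ optimal_usdm H' rho1' rho2' p1' p2' Fq' F1' F2',
           F1 = F1', F2 = F2' & Fq = Fq' + Pcap])
  /\
  (forall Fq F1 F2 Fq' F1' F2' : 'M[R[i]]_n,
     optimal_usdm H rho1 rho2 p1 p2 Fq F1 F2 ->
     optimal_usdm H' rho1' rho2' p1' p2' Fq' F1' F2' ->
     F1 = F1' -> F2 = F2' -> Fq = Fq' + Pcap ->
     failure_prob rho1 rho2 p1 p2 Fq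
     = (1 - N1) * p1 + (1 - N2) * p2
       + N * failure_prob rho1' rho2' p1' p2' Fq').
Proof.
have reduced := optimal_usdm_reduced rho1_density rho2_density p1_ge0 p2_ge0.
move=> S1 S2 H Hcap H' Pcap P' N1 N2 N rho1' rho2' p1' p2' _; split.
  move=> Fq F1 F2; split=> [opt|[Fq' [F1' [F2' [opt -> -> ->]]]]].
    exists (Fq - Pcap), F1, F2.
    split; [exact: (reduced Fq F1 F2).1 opt | by [] | by [] |].
    by rewrite subrK.
  by apply: (reduced _ F1' F2').2; rewrite -/S1 addrK.
move=> Fq F1 F2 Fq' F1' F2' _ [[[ops _] _ _] _] _ _ ->.
(* The reduced POVM places [Fq'] on [H'], where the affine law for the failure probability holds. *)
have [Fq'H' _] := ops _ (mem_head _ _).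
exact: (failure_prob_reduced rho1_density rho2_density p1_ge0 p2_ge0 Fq'H').
Qed.
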